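(* Let $M$ be a $\mathbb{Z}^n$-graded submodule of a finitely generated $\mathbb{Z}^n$-graded free $S$-module $F_0$, and let $$\cdots\to F_p\to F_{p-1}\to\cdots\to F_1\to M\to 0$$ be a $\mathbb{Z}^n$-graded (not necessarily minimal) free resolution of $M$ with all $F_i$ finitely generated. Then for every $p\ge 0$ the $p$-th syzygy module $Z_p$ has Stanley depth greater than or equal to $p+1$, or it is a free module.
   Context: $K$ is a field and $S=K[x_1,\dots,x_n]$ with its standard $\mathbb{Z}^n$-grading. Syzygy modules: composing $F_1\to M$ with the inclusion $M\subseteq F_0$ gives maps $F_p\to F_{p-1}$ for all $p\ge 1$; set $Z_0=M\subseteq F_0$ and $Z_p=\ker(F_p\to F_{p-1})\subseteq F_p$ for $p\ge1$. The zero module is free. Stanley depth: a Stanley decomposition of a finitely generated $\mathbb{Z}^n$-graded $S$-module $M$ is a finite direct sum decomposition $M=\bigoplus_{i=1}^r u_iK[Z_i]$ as a $\mathbb{Z}^n$-graded $K$-vector space, where each $u_i\in M$ is a homogeneous element, $Z_i\subseteq\{x_1,\dots,x_n\}$ is a set of variables (here $Z_i$ does not denote a syzygy module), and $u_iK[Z_i]$ is a free $K[Z_i]$-submodule of $M$. The Stanley depth of the decomposition is $\min_i|Z_i|$, and the Stanley depth of $M$, $\operatorname{sdepth} M$, is the maximum of the Stanley depths of its Stanley decompositions. *)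

(* Defs.v *)
From HB Require Import structures.
From mathcomp Require Import all_boot all_order all_algebra.
From mathcomp Require Import mpoly.

Set Implicit Arguments.
Unset Strict Implicit.
Unset Printing Implicit Defensive.

Import GRing.Theory.
Local Open Scope ring_scope.

(* Submodules and subspaces of a module V are predicates V -> Prop: membership
   in a kernel or an image need not be decidable. *)

(* N is the internal direct sum of the subgroups W i. *)
Definition direct_sum (V : zmodType) (I : choiceType)
    (W : I -> V -> Prop) (N : V -> Prop) : Prop :=
  (forall x, N x <->
     exists (s : seq I) (f : I -> V),
       [/\ uniq s, forall i, W i (f i) & x = \sum_(i <- s) f i])
  /\ (forall (s : seq I) (f : I -> V),
        uniq s -> (forall i, W i (f i)) ->
        \sum_(i <- s) f i = 0 -> forall i, i \in s -> f i = 0).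

Definition multidegree (n : nat) (m : 'X_{1..n}) : {ffun 'I_n -> int} :=
  [ffun i => (m i)%:Z].

(* The case m = 0 of zn_grading_act says that each component is a K-subspace. *)
Record zn_grading (K : fieldType) (n : nat) (V : lmodType {mpoly K[n]})
    (gr : {ffun 'I_n -> int} -> V -> Prop) : Prop := ZnGrading {
  zn_grading_zero : forall g, gr g 0;
  zn_grading_add : forall g x y, gr g x -> gr g y -> gr g (x + y);
  zn_grading_act : forall g (m : 'X_{1..n}) (c : K) x,
    gr g x -> gr (multidegree m + g) ((c *: 'X_[m] : {mpoly K[n]}) *: x);
  zn_grading_sum : direct_sum gr (fun _ => True)
}.

Record graded_submodule (K : fieldType) (n : nat) (V : lmodType {mpoly K[n]})
    (gr : {ffun 'I_n -> int} -> V -> Prop) (N : V -> Prop) : Prop :=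
  GradedSubmodule {
  graded_submodule_zero : N 0;
  graded_submodule_add : forall x y, N x -> N y -> N (x + y);
  graded_submodule_scale : forall (a : {mpoly K[n]}) x, N x -> N (a *: x);
  graded_submodule_sum : direct_sum (fun g x => gr g x /\ N x) N
}.

Definition is_basis (R : pzRingType) (V : lmodType R) (N : V -> Prop)
    (r : nat) (b : 'I_r -> V) : Prop :=
  [/\ forall i, N (b i),
      forall x, N x -> exists c : 'I_r -> R, x = \sum_(i < r) c i *: b i
    & forall c : 'I_r -> R, \sum_(i < r) c i *: b i = 0 -> forall i, c i = 0].

(* r = 0 is allowed, so the zero module is free. *)
Definition is_free (R : pzRingType) (V : lmodType R) (N : V -> Prop) : Prop :=
  exists (r : nat) (b : 'I_r -> V), is_basis N b.

Definition fg_graded_free (K : fieldType) (n : nat)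
    (V : lmodType {mpoly K[n]}) (gr : {ffun 'I_n -> int} -> V -> Prop) : Prop :=
  zn_grading gr /\
  exists (r : nat) (b : 'I_r -> V),
    is_basis (fun _ => True) b /\ forall i, exists g, gr g (b i).

(* d 0 is the composite of F 1 -> M with the inclusion of M in F 0. *)
Record graded_free_resolution (K : fieldType) (n : nat)
    (F : nat -> lmodType {mpoly K[n]})
    (gr : forall p, {ffun 'I_n -> int} -> F p -> Prop)
    (d : forall p, {linear F p.+1 -> F p}) (M : F 0%N -> Prop) : Prop :=
  GradedFreeResolution {
  resolution_free : forall p, fg_graded_free (gr p.+1);
  resolution_graded : forall p g x, gr p.+1 g x -> gr p g (d p x);
  resolution_onto : forall x, M x <-> exists y, d 0%N y = x;
  resolution_exact : forall p x, d p x = 0 <-> exists y, d p.+1 y = x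
}.

Definition syzygy (R : pzRingType) (F : nat -> lmodType R)
    (d : forall p, {linear F p.+1 -> F p}) (M : F 0%N -> Prop) (p : nat) :
    F p -> Prop :=
  match p return F p -> Prop with
  | 0%N => M
  | q.+1 => fun x => d q x = 0
  end.
Arguments syzygy {R F} d M p _.

(* f \in K[Z] *)
Definition poly_in_vars (K : fieldType) (n : nat) (Z : {set 'I_n})
    (f : {mpoly K[n]}) : Prop :=
  forall m : 'X_{1..n}, m \in msupp f -> forall i, m i != 0%N -> i \in Z.

(* u i K[Z i] is free over K[Z i] on the generator u i. *)
Record stanley_decomposition (K : fieldType) (n : nat)
    (V : lmodType {mpoly K[n]}) (gr : {ffun 'I_n -> int} -> V -> Prop)
    (N : V -> Prop) (r : nat) (u : 'I_r -> V) (Z : 'I_r -> {set 'I_n}) : Prop :=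
  StanleyDecomposition {
  stanley_mem : forall i, N (u i);
  stanley_homogeneous : forall i, exists g, gr g (u i);
  stanley_free : forall i f, poly_in_vars (Z i) f -> f *: u i = 0 -> f = 0;
  stanley_sum :
    direct_sum (fun i x => exists2 f, poly_in_vars (Z i) f & x = f *: u i) N
}.

(* The default n bounds every #|Z i|, so it only matters for r = 0, that is for
   the empty decomposition of the zero module. *)
Definition decomposition_depth (n r : nat) (Z : 'I_r -> {set 'I_n}) : nat :=
  \big[minn/n]_(i < r) #|Z i|.

(* sdepth N = k, with N seen as a graded module through the grading of V. *)
Definition is_sdepth (K : fieldType) (n : nat) (V : lmodType {mpoly K[n]})
    (gr : {ffun 'I_n -> int} -> V -> Prop) (N : V -> Prop) (k : nat) : Prop :=
  (exists (r : nat) (u : 'I_r -> V) (Z : 'I_r -> {set 'I_n}),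
     stanley_decomposition gr N u Z /\ decomposition_depth Z = k)
  /\ (forall (r : nat) (u : 'I_r -> V) (Z : 'I_r -> {set 'I_n}),
        stanley_decomposition gr N u Z -> (decomposition_depth Z <= k)%N).

(* Main.v *)
Require Import Defs.
From mathcomp Require Import all_boot all_order all_algebra.
From mathcomp Require Import zify.
From mathcomp Require Import mpoly.
From Stdlib Require Import ClassicalEpsilon.

(** Order the homogeneous basis of F_p along the lexicographic order of the
    degrees, and take as leading term of a homogeneous element its term on the
    largest basis element; as all terms have the same degree, the leading
    exponent is the lexicographically smallest one. The key point is that the
    initial module of Z_p is generated by terms x^m e_i with m free of the first
    p variables x_0, ..., x_{p-1} ([lead_zero_below]).

    Suppose that x_j, with j < p, is the first variable dividing the leading
    monomial of z in Z_p. As the leading exponent is the smallest one, z lies in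
    (x_0, ..., x_j) F_p, say z = x_j y modulo I = (x_0, ..., x_{j-1}). Since x_j
    is regular modulo I, y is a cycle modulo I. The resolution stays exact in
    degree p modulo I, because I is generated by a regular sequence of j < p
    elements ([lift_cycle]); so y is congruent to a cycle modulo I, and a
    homogeneous component of that cycle has the leading monomial of z divided
    by x_j ([syzygy_saturated], [lead_zero_below]).

    The leading exponents on e_i thus form a monomial ideal generated in the
    variables x_p, ..., x_{n-1}. By Dickson's lemma such an ideal is a finite
    disjoint union of boxes x^a K[Z] in which x_0, ..., x_{p-1} are free
    directions, and also x_p if p < n ([box_partition]). Elements of Z_p with
    leading terms x^a e_i give a Stanley decomposition with the same sets Z, by
    the usual cancellation of leading terms ([boxes_stanley]). If p < n then
    every Z has at least p + 1 elements. If p >= n then every Z is the set of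
    all variables, and the decomposition is a basis of Z_p
    ([full_boxes_free]). *)

Set Implicit Arguments.
Unset Strict Implicit.
Unset Printing Implicit Defensive.

Import Order.TTheory GRing.Theory Num.Theory.
Local Open Scope ring_scope.

(** * Decisions, bounds and extrema *)

(** The truth value of P, by excluded middle. *)
Definition decide (P : Prop) : bool := excluded_middle_informative P.

Lemma decideP P : reflect P (decide P).
Proof.
by rewrite /decide; case: excluded_middle_informative => h; constructor.
Qed.

Lemma fin_exists_bound (I : finType) (P : I -> nat -> Prop) :
  (forall i c c', (c <= c')%N -> P i c -> P i c') ->
  (forall i, exists c, P i c) -> exists C, forall i, P i C.
Proof.
move=> mono ex.
have [C hC] : exists C, forall i, i \in enum I -> P i C.
  elim: (enum I) => [|i s [C hC]]; first by exists 0%N.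
  have [c hc] := ex i; exists (maxn c C) => k; rewrite inE => /predU1P[->|ks].
    exact: mono (leq_maxl _ _) hc.
  exact: mono (leq_maxr _ _) (hC k ks).
by exists C => i; apply: hC; rewrite mem_enum.
Qed.

Lemma exists_max_nat (P : nat -> Prop) (k0 n : nat) :
  P k0 -> (forall k, P k -> (k <= n)%N) ->
  exists k, [/\ P k, (k0 <= k)%N & forall k', P k' -> (k' <= k)%N].
Proof.
move=> Pk0 bound.
pose b k := decide (P k).
have bP k : reflect (P k) (b k) := decideP _.
have exb : exists k, b k by exists k0; apply/bP.
have ubb k : b k -> (k <= n)%N by move/bP; apply: bound.
case: (ex_maxnP exb ubb) => k /bP Pk kmax; exists k; split=> // [|k' /bP].
  by apply: kmax; apply/bP.
exact: kmax.
Qed.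

Lemma exists_min_nat (P : nat -> Prop) :
  (exists k, P k) -> exists k, P k /\ forall k', P k' -> (k <= k')%N.
Proof.
move=> [k0 Pk0].
pose b k := decide (P k).
have bP k : reflect (P k) (b k) := decideP _.
have exb : exists k, b k by exists k0; apply/bP.
case: (ex_minnP exb) => k /bP Pk kmin; exists k; split=> // k' /bP.
exact: kmin.
Qed.

(** * Monomial ideals *)

(** The exponents of the monomials of a monomial ideal: a set of exponents that
    is closed upwards for divisibility. *)
Definition mono_ideal n (U : 'X_{1..n} -> Prop) : Prop :=
  forall m m' : 'X_{1..n}, (m <= m')%MM -> U m -> U m'.

(** All exponents of m cut off at N. *)
Definition truncm n (N : nat) (m : 'X_{1..n}) : 'X_{1..n} :=
  [multinom minn (m i) N | i < n].

Lemma truncm_le n N N' (m : 'X_{1..n}) :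
  (N <= N')%N -> (truncm N m <= truncm N' m)%MM.
Proof. by move=> h; apply/mnm_lepP => i; rewrite !mnmE; lia. Qed.

(** Dickson's lemma for monomials in the first q variables, stated as: the
    ideal is determined by its exponents that are bounded by some N. The slices
    of U at a fixed exponent c of the last variable form an increasing sequence
    of ideals, which is constant from some C on. *)
Lemma dickson_below n (q : nat) (U : 'X_{1..n} -> Prop) :
  mono_ideal U ->
  exists N, forall m : 'X_{1..n},
    (forall i : 'I_n, (q <= i)%N -> m i = 0%N) -> U m -> U (truncm N m).
Proof.
elim: q U => [|q IHq] U upU.
  exists 0%N => m m0; congr U; apply/mnmP => i.
  by rewrite mnmE m0.
case: (ltnP q n) => [ltqn|leqn]; last first.
  have [N hN] := IHq U upU; exists N => m m0; apply: hN => i qi.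
  by have := ltn_ord i; lia.
pose o := Ordinal ltqn.
pose upd (c : nat) (m : 'X_{1..n}) : 'X_{1..n} :=
  [multinom if i == o then c else m i | i < n].
pose Uc c m := U (upd c m).
have updE c m i : upd c m i = if i == o then c else m i by rewrite mnmE.
have upUc c : mono_ideal (Uc c).
  move=> m m' /mnm_lepP le; apply: upU; apply/mnm_lepP => i.
  by rewrite !updE; case: eqP.
have monoUc c c' m : (c <= c')%N -> Uc c m -> Uc c' m.
  move=> le; apply: upU; apply/mnm_lepP => i.
  by rewrite !updE; case: eqP.
have upUoo : mono_ideal (fun m => exists c, Uc c m).
  by move=> m m' le [c Ucm]; exists c; apply: upUc le Ucm.
have [Noo hNoo] := IHq _ upUoo.
pose mk (t : {ffun 'I_n -> 'I_Noo.+1}) : 'X_{1..n} :=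
  [multinom t i : nat | i < n].
(* The union of the slices is determined by finitely many bounded exponents,
   so that it is already reached by a single slice. *)
have [C hC] : exists C, forall t, (exists c, Uc c (mk t)) -> Uc C (mk t).
  apply: fin_exists_bound => [t c c' le h /h|t]; first exact: monoUc.
  case: (classic (exists c, Uc c (mk t))) => [[c h]|no]; first by exists c.
  by exists 0%N => /no.
(* A common bound for the slices before C. *)
have [N hN] : exists N, forall c : 'I_C, forall m : 'X_{1..n},
    (forall i : 'I_n, (q <= i)%N -> m i = 0%N) -> Uc c m -> Uc c (truncm N m).
  apply: fin_exists_bound => [c N N' le h m m0 Um|c]; last exact: IHq.
  exact: upUc (truncm_le _ le) (h m m0 Um).
exists (maxn C (maxn Noo N)) => m m0 Um.
have Um' : Uc (m o) (upd 0%N m).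
  congr U: Um; apply/mnmP => i; rewrite !updE.
  by case: eqP => [->|].
have m'0 (i : 'I_n) : (q <= i)%N -> upd 0%N m i = 0%N.
  rewrite updE; case: eqP => // io qi; apply: m0.
  by rewrite ltn_neqAle qi andbT; apply/eqP => e; apply: io; apply: val_inj.
case: (ltnP (m o) C) => [lt|ge].
  apply: upU (hN (Ordinal lt) _ m'0 Um'); apply/mnm_lepP => i.
  by rewrite updE !mnmE /=; case: eqP => [->|_]; lia.
have exU : exists c, Uc c (truncm Noo (upd 0%N m)).
  by apply: hNoo m'0 _; exists (m o).
pose t := [ffun i : 'I_n => inord (minn (upd 0%N m i) Noo) : 'I_Noo.+1].
have tE : truncm Noo (upd 0%N m) = mk t.
  by apply/mnmP => i; rewrite [LHS]mnmE [RHS]mnmE ffunE inordK // ltnS geq_minr.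
rewrite tE in exU; have := hC t exU; rewrite -tE.
apply: upU; apply/mnm_lepP => i.
by rewrite updE !mnmE /=; case: eqP => [->|_]; lia.
Qed.

Lemma dickson_trunc n (U : 'X_{1..n} -> Prop) :
  mono_ideal U -> exists N, forall m, U m -> U (truncm N m).
Proof.
move=> /(@dickson_below n n)[N hN]; exists N => m Um; apply: hN => // i.
by have := ltn_ord i; lia.
Qed.

(** m is the exponent of a monomial of x^a K[Z]. *)
Definition in_box n (a : 'X_{1..n}) (Z : {set 'I_n}) (m : 'X_{1..n}) : Prop :=
  forall i, (a i <= m i)%N /\ (i \notin Z -> m i = a i).

(** The monomial m with the first p variables set to 1. *)
Definition zero_below n (p : nat) (m : 'X_{1..n}) : 'X_{1..n} :=
  [multinom if (i < p)%N then 0%N else m i | i < n].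

(** A finite family of monomial ideals U e, each generated by monomials in the
    variables of index at least p, is partitioned into finitely many boxes
    whose free directions include the variables of index at most p. Bound the
    exponents of generators by N. There is one box for each choice s of
    exponents at most N of the variables of index greater than p, as soon as
    the ideal meets the line of direction x_p through s: the box starts at the
    first point of the ideal on this line, and its free directions are those
    of index at most p and those in which s reaches N. For p >= n there is no
    variable x_p, and the only box of a nonzero ideal is the whole orthant. *)
Lemma box_partition n (I : finType) (p : nat) (U : I -> 'X_{1..n} -> Prop) :
  (forall e, mono_ideal (U e)) ->
  (forall e m, U e m -> U e (zero_below p m)) ->
  exists (k : nat) (e : 'I_k -> I) (a : 'I_k -> 'X_{1..n})
    (Z : 'I_k -> {set 'I_n}),
    [/\ forall j, U (e j) (a j),
        forall c m, U c m -> exists j, e j = c /\ in_box (a j) (Z j) m,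
        forall m j j', e j = e j' ->
          in_box (a j) (Z j) m -> in_box (a j') (Z j') m -> j = j'
      & forall j (i : 'I_n), (i <= p)%N -> i \in Z j].
Proof.
move=> upU zU.
have [N hN] : exists N, forall c m, U c m -> U c (truncm N m).
  apply: fin_exists_bound => [c N N' le h m /h|c]; last exact: dickson_trunc.
  exact: upU (truncm_le _ le).
pose T := {ffun 'I_n -> 'I_N.+1}.
(* The point at height c of the line through s. *)
pose pt (s : T) (c : nat) : 'X_{1..n} :=
  [multinom if (i < p)%N then 0%N else if i == p :> nat then c else s i
  | i < n].
pose good (x : I * T) := (forall i : 'I_n, (i <= p)%N -> x.2 i = ord0) /\
  exists c, U x.1 (pt x.2 c).
pose A := [set x : I * T | decide (good x)].
have AP x : reflect (good x) (x \in A) by rewrite inE; apply: decideP.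
have minc (x : I * T) : exists c, good x ->
    U x.1 (pt x.2 c) /\ forall c', U x.1 (pt x.2 c') -> (c <= c')%N.
  case: (classic (good x)) => [[_ /exists_min_nat[c hc]]|no]; first by exists c.
  by exists 0%N => /no.
pose h x := proj1_sig (constructive_indefinite_description _ (minc x)).
have hP x : good x -> U x.1 (pt x.2 (h x)) /\
    forall c', U x.1 (pt x.2 c') -> (h x <= c')%N.
  by rewrite /h; case: constructive_indefinite_description => c /= hc /hc.
pose box (x : I * T) : {set 'I_n} :=
  [set i : 'I_n | (i <= p)%N || (x.2 i == N :> nat)].
(* The choice of exponents whose box contains m. *)
pose tau (m : 'X_{1..n}) : T :=
  [ffun i : 'I_n => inord (if (i <= p)%N then 0%N else minn (m i) N)].
have tauE m i : tau m i = (if (i <= p)%N then 0%N else minn (m i) N) :> nat.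
  by rewrite ffunE inordK //; case: ifP => _; lia.
have boxU x m : good x -> in_box (pt x.2 (h x)) (box x) m -> x.2 = tau m.
  move=> [s0 _] bx; apply/ffunP => i; apply: val_inj; rewrite /= tauE.
  case: ifP => [ip|ip]; first by rewrite s0.
  have [] := bx i; rewrite !mnmE inE ip /=.
  have -> : (i < p)%N = false by lia.
  have -> : (i == p :> nat) = false by lia.
  have := ltn_ord (x.2 i); case: eqP => [->|_ lt le]; first by lia.
  by move/(_ isT) => e; lia.
exists #|A|, (fun j => (enum_val j).1),
  (fun j => pt (enum_val j).2 (h (enum_val j))), (fun j => box (enum_val j)).
have gA (j : 'I_#|A|) : good (enum_val j) by apply/AP; apply: enum_valP.
split.
- by move=> j; have [] := hP _ (gA j).
- move=> c m Um.
  have [n0|np] : (forall i : 'I_n, (i < p)%N) \/ exists o : 'I_n, o = p :> nat.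
    case: (ltnP p n) => [lt|le]; first by right; exists (Ordinal lt).
    by left=> i; apply: leq_trans le.
  - have g : good (c, tau m).
      split=> [i ip|]; first by apply: val_inj; rewrite /= tauE ip.
      exists 0%N; apply: upU (zU _ _ Um); apply/mnm_lepP => i.
      by rewrite !mnmE n0.
    move/AP: (g) => cA; exists (enum_rank_in cA (c, tau m)).
    rewrite enum_rankK_in //; split=> // i; rewrite !mnmE inE n0; split=> //.
    by have := n0 i; rewrite -ltnS; case: leqP => //; lia.
  case: np => o oE.
  have Ut : U c (pt (tau m) (m o)).
    apply: upU (hN _ _ (zU _ _ Um)); apply/mnm_lepP => i.
    rewrite !mnmE tauE; case: ltnP => pi; first by rewrite min0n.
    case: (i =P p :> nat) => [ip|ip]; last by case: (leqP i p) => ?; lia.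
    by rewrite (_ : i = o); [lia | apply: val_inj; rewrite /= oE].
  have g : good (c, tau m).
    split=> [i ip|]; first by apply: val_inj; rewrite /= tauE ip.
    by exists (m o).
  move/AP: (g) => cA; exists (enum_rank_in cA (c, tau m)).
  rewrite enum_rankK_in //; split=> // i.
  have /= [_ /(_ _ Ut) hle] := hP _ g.
  rewrite !mnmE inE /= tauE; case: (ltngtP i p) => ip //=.
    split; first lia.
    case: (leqP (m i) N) => mN; last by rewrite eqxx.
    by move=> _.
  split=> //; rewrite (_ : i = o) //; apply: val_inj; rewrite /= oE; exact: ip.
- move=> m j j' ej bj bj'; apply: enum_val_inj.
  have := boxU _ _ (gA j) bj; have := boxU _ _ (gA j') bj'.
  by case: (enum_val j) (enum_val j') ej => [x s] [x' s'] /= -> -> ->.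
- by move=> j i ip; rewrite inE ip.
Qed.

(** * Coefficients of polynomials *)

Lemma mcoeffMX_ge (K : fieldType) n (f : {mpoly K[n]}) (t m : 'X_{1..n}) :
  (t <= m)%MM -> ('X_[t] * f)@_m = f@_(m - t).
Proof. by move=> /submK {1}<-; rewrite addmC mulrC mcoeffMX. Qed.

Lemma mcoeffMX_nge (K : fieldType) n (f : {mpoly K[n]}) (t m : 'X_{1..n}) :
  ~~ (t <= m)%MM -> ('X_[t] * f)@_m = 0.
Proof.
move=> ntm; apply/eqP; rewrite mcoeff_eq0; apply: contra ntm => mX.
have : m \in msupp (f * 'X_[t]) by rewrite mulrC.
rewrite (perm_mem (msuppMX f t)) => /mapP[m' _ ->].
exact: lem_addr.
Qed.

(** The sum of the terms of f whose monomials satisfy P. *)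
Definition mfilter (K : fieldType) n (P : pred 'X_{1..n}) (f : {mpoly K[n]}) :
  {mpoly K[n]} := \sum_(m <- msupp f | P m) f@_m *: 'X_[m].

Lemma mcoeff_mfilter (K : fieldType) n P (f : {mpoly K[n]}) m :
  (mfilter P f)@_m = if P m then f@_m else 0.
Proof.
rewrite /mfilter raddf_sum /=.
rewrite (eq_bigr (fun k => if k == m then f@_m else 0)); last first.
  move=> k _; rewrite mcoeffZ mcoeffX; case: eqP => [->|_].
    by rewrite mulr1.
  by rewrite mulr0.
rewrite -big_mkcondr /=; case: (boolP (m \in msupp f)) => mf; last first.
  rewrite -mcoeff_eq0 in mf; rewrite (eqP mf) if_same big1 //.
rewrite big_mkcond (bigD1_seq m) ?msupp_uniq //= eqxx andbT big1 ?addr0 //.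
by move=> k /negPf ->; rewrite andbF.
Qed.

Lemma multidegreeD n (m m' : 'X_{1..n}) (g : {ffun 'I_n -> int}) :
  multidegree (m + m') + g = multidegree m + (multidegree m' + g).
Proof. by apply/ffunP => i; rewrite !ffunE mnmDE PoszD addrA. Qed.

Lemma multidegree_inj n (g : {ffun 'I_n -> int}) :
  injective (fun m : 'X_{1..n} => multidegree m + g).
Proof.
move=> m m' /ffunP e; apply/mnmP => i.
by have := e i; rewrite !ffunE => /addIr[].
Qed.

(** * Coordinates in a free module *)

Section Coordinates.
Context (R : pzRingType) (V : lmodType R) (r : nat) (b : 'I_r -> V).
Context (basis_b : is_basis (fun _ => True) b).

Let generates x : exists c : 'I_r -> R, x = \sum_(i < r) c i *: b i.
Proof. by case: basis_b => _ /(_ x I). Qed.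

(** The coordinates of x in the basis b. *)
Definition coord x : 'I_r -> R :=
  proj1_sig (constructive_indefinite_description _ (generates x)).

Lemma coordE x : x = \sum_(i < r) coord x i *: b i.
Proof. by rewrite /coord; case: constructive_indefinite_description. Qed.

Lemma coord_sum c i : coord (\sum_(i < r) c i *: b i) i = c i.
Proof.
case: basis_b => _ _ free_b; apply/eqP; rewrite -subr_eq0; apply/eqP.
move: i; apply: (free_b (fun i => coord (\sum_(i < r) c i *: b i) i - c i)).
under eq_bigr do rewrite scalerBl.
by rewrite sumrB -coordE subrr.
Qed.

Lemma coordD x y i : coord (x + y) i = coord x i + coord y i.
Proof.
rewrite {1}(coordE x) {1}(coordE y) -big_split /=.
under eq_bigr do rewrite -scalerDl.
by rewrite (coord_sum (fun i => coord x i + coord y i)).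
Qed.

Lemma coordZ a x i : coord (a *: x) i = a * coord x i.
Proof.
rewrite {1}(coordE x) scaler_sumr.
under eq_bigr do rewrite scalerA.
by rewrite (coord_sum (fun i => a * coord x i)).
Qed.

Lemma coordB x y i : coord (x - y) i = coord x i - coord y i.
Proof. by rewrite coordD -scaleN1r coordZ mulN1r. Qed.

Lemma coord0 i : coord 0 i = 0.
Proof. by rewrite -(scale0r (0 : V)) coordZ mul0r. Qed.

Lemma coord_bigsum (J : Type) (s : seq J) P (f : J -> V) i :
  coord (\sum_(j <- s | P j) f j) i = \sum_(j <- s | P j) coord (f j) i.
Proof.
elim/big_rec2: _ => [|j y x _ <-]; first exact: coord0.
exact: coordD.
Qed.

Lemma coord_inj x y : (forall i, coord x i = coord y i) -> x = y.
Proof.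
by move=> e; rewrite (coordE x) (coordE y); apply: eq_bigr => i _; rewrite e.
Qed.

End Coordinates.

(** * Regular sequences of variables *)

Section InVars.
Context (K : fieldType) (n : nat).

(** x lies in the submodule I V, where I is the ideal generated by the
    variables whose indices are in s. The recursive form is the one that the
    inductions on s consume. *)
Fixpoint in_vars (V : lmodType {mpoly K[n]}) (s : seq 'I_n) (x : V) : Prop :=
  match s with
  | [::] => x = 0
  | j :: s' => exists y, in_vars s' (x - ('X_j : {mpoly K[n]}) *: y)
  end.

Lemma in_vars_linear (V W : lmodType {mpoly K[n]}) (d : {linear V -> W}) s x :
  in_vars s x -> in_vars s (d x).
Proof.
elim: s x => [|j s IHs] x /=; first by move=> ->; rewrite linear0.
by move=> [y /IHs]; rewrite linearB linearZ; exists (d y).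
Qed.

Context (V : lmodType {mpoly K[n]}).
Implicit Types (s : seq 'I_n) (x y : V).

Lemma in_varsD s x y : in_vars s x -> in_vars s y -> in_vars s (x + y).
Proof.
elim: s x y => [|j s IHs] x y /=; first by move=> -> ->; rewrite addr0.
move=> [x' hx] [y' hy]; exists (x' + y').
by have := IHs _ _ hx hy; rewrite scalerDr opprD addrACA.
Qed.

Lemma in_varsZ s (a : {mpoly K[n]}) x : in_vars s x -> in_vars s (a *: x).
Proof.
elim: s x => [|j s IHs] x /=; first by move=> ->; rewrite scaler0.
move=> [y /IHs]; rewrite scalerBr scalerA mulrC -scalerA.
by exists (a *: y).
Qed.

Lemma in_varsN s x : in_vars s x -> in_vars s (- x).
Proof. by rewrite -scaleN1r; apply: in_varsZ. Qed.

Context (r : nat) (b : 'I_r -> V).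
Context (basis_b : is_basis (fun _ => True) b).

(** In a free module, I V consists of the elements whose terms are all
    divisible by a variable with index in s. *)
Lemma in_varsP s x :
  in_vars s x <-> forall i (m : 'X_{1..n}), (forall j, j \in s -> m j = 0%N) ->
                    (coord basis_b x i)@_m = 0.
Proof.
elim: s x => [|j s IHs] x /=.
  split=> [-> i m _|x0]; first by rewrite coord0 mcoeff0.
  apply: (@coord_inj _ _ _ _ basis_b) => i.
  by apply/mpolyP => m; rewrite coord0 mcoeff0 x0.
split=> [[y /IHs hy] i m m0|x0].
  have := hy i m (fun k ks => m0 k (mem_behead (s := j :: s) ks)).
  rewrite coordB coordZ mcoeffB mcoeffMX_nge ?subr0 //.
  apply/negP => /mnm_lepP/(_ j); rewrite mnm1E eqxx m0 //; exact: mem_head.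
(* The sum of the terms divisible by the variable, divided by it. *)
pose q i := \sum_(m <- msupp (coord basis_b x i) | m j != 0%N)
   (coord basis_b x i)@_m *: 'X_[m - U_(j)].
have qE i : 'X_j * q i = mfilter (fun m => m j != 0%N) (coord basis_b x i).
  rewrite mulr_sumr; apply: eq_bigr => m mj.
  rewrite -scalerAr -mpolyXD addmC submK //; apply/mnm_lepP => k.
  by rewrite mnm1E; case: eqP => [<-|//]; rewrite lt0n.
exists (\sum_i q i *: b i); apply/IHs => i m m0.
rewrite coordB coordZ coord_sum qE mcoeffB mcoeff_mfilter.
case: eqP => [mj|_]; last by rewrite subrr.
by rewrite subr0 x0 // => k; rewrite inE => /predU1P[->|/m0].
Qed.

Lemma in_vars_regular s j x : j \notin s ->
  in_vars s (('X_j : {mpoly K[n]}) *: x) -> in_vars s x.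
Proof.
move=> js /in_varsP h; apply/in_varsP => i m m0.
have := h i (U_(j) + m)%MM; rewrite coordZ mcoeffMX_ge ?lem_addr // addmC addmK.
apply=> k ks; rewrite mnmDE m0 // mnm1E.
by case: eqP => // e; rewrite e ks in js.
Qed.

End InVars.

(** If w is a cycle modulo the ideal I generated by the variables in s, then w
    is congruent modulo I to a cycle, provided that s has at most p elements.
    For p + 1 the homological degree of w, this is the vanishing of
    Tor_{p+1}(F_0 / M, S / I), which is proved by induction along the regular
    sequence s. *)
Lemma lift_cycle (K : fieldType) (n : nat) (F : nat -> lmodType {mpoly K[n]})
    (d : forall p, {linear F p.+1 -> F p})
    (F_free : forall p, exists (r : nat) (b : 'I_r -> F p),
       is_basis (fun _ => True) b)
    (exact_d : forall p x, d p x = 0 <-> exists y, d p.+1 y = x)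
    (s : seq 'I_n) (p : nat) (w : F p.+1) :
  uniq s -> (size s <= p)%N -> in_vars s (d p w) ->
  exists z, d p z = 0 /\ in_vars s (w - z).
Proof.
elim: s p w => [|j s IHs] p w /=.
  by move=> _ _ dw; exists w; rewrite subrr.
case: p w => // q w /andP[js us] sq [y hy].
have hdy : in_vars s (d q y).
  have [r [b basis_b]] := F_free q.
  apply: (in_vars_regular basis_b js).
  have ddw : d q (d q.+1 w) = 0 by apply/exact_d; exists w.
  have := in_vars_linear (d q) hy.
  by rewrite linearB linearZ ddw sub0r => /in_varsN; rewrite opprK.
have [y' [/exact_d[v dv] hy']] := IHs q y us sq hdy.
have hw : in_vars s (d q.+1 (w - ('X_j : {mpoly K[n]}) *: v)).
  have := in_varsD hy (in_varsZ 'X_j hy').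
  have -> : d q.+1 (w - ('X_j : {mpoly K[n]}) *: v) = d q.+1 w - 'X_j *: y'.
    by rewrite -dv linearB linearZ.
  by rewrite scalerBr addrA subrK.
have [z [dz hz]] := IHs _ _ us (leqW sq) hw.
by exists z; split=> //; exists v; rewrite addrAC.
Qed.

(** * Order on the basis *)

(** The lexicographic order: at the first index where g and h differ, the value
    of g is the smaller one. *)
Definition lexle n (g h : {ffun 'I_n -> int}) : bool :=
  [forall j : 'I_n,
     [forall k : 'I_n, (k < j)%N ==> (g k == h k)] ==> (g j <= h j)].

Lemma lexleP n (g h : {ffun 'I_n -> int}) :
  reflect (forall j : 'I_n,
      (forall k : 'I_n, (k < j)%N -> g k = h k) -> g j <= h j)
    (lexle g h).
Proof.
apply: (iffP forallP) => [le j e|le j].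
  apply: (implyP (le j)); apply/forallP => k; apply/implyP => kj.
  by rewrite e.
by apply/implyP => /forallP e; apply: le => k kj; apply/eqP/(implyP (e k)).
Qed.

Lemma lexle_total n : total (@lexle n).
Proof.
move=> g h; case: (boolP (lexle g h)) => //= /forallPn[j].
rewrite negb_imply => /andP[/forallP e]; rewrite -ltNge => ltj.
have {}e (k : 'I_n) : (k < j)%N -> g k = h k.
  by move=> kj; apply/eqP/(implyP (e k)).
apply/lexleP => k ek; case: (ltngtP k j) => kj.
- by rewrite e.
- by move: ltj; rewrite ek ?ltxx.
- by rewrite (val_inj kj) ltW.
Qed.

Lemma lexle_trans n : transitive (@lexle n).
Proof.
move=> h g l /lexleP gh /lexleP hl.
apply/lexleP => j e.
suff egh (k : 'I_n) : (k < j)%N -> g k = h k.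
  by apply: le_trans (gh j egh) (hl j _) => k kj; rewrite -egh // e.
have [q] := ubnP k; elim: q k => // q IHq k kq kj; apply: le_anti.
have lower (k' : 'I_n) : (k' < k)%N -> g k' = h k'.
  by move=> k'k; apply: IHq (leq_trans k'k kq) (ltn_trans k'k kj).
rewrite gh //= (e k kj) hl // => k' k'k.
by rewrite -lower // e //; apply: ltn_trans kj.
Qed.

(** The basis elements can be numbered along their degrees g. *)
Lemma exists_lex_rank n r (g : 'I_r -> {ffun 'I_n -> int}) :
  exists rho : 'I_r -> nat, [/\ injective rho, forall i, (rho i < r)%N
    & forall i i', (rho i <= rho i')%N -> lexle (g i) (g i')].
Proof.
pose le i i' := lexle (g i) (g i').
have le_total : total le by move=> i i'; apply: lexle_total.
have le_trans : transitive le by move=> i i' i''; apply: lexle_trans.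
pose s := sort le (enum 'I_r).
have ins i : i \in s by rewrite mem_sort mem_enum.
exists (index^~ s); split.
- by move=> i i' e; rewrite -(nth_index i (ins i)) e nth_index.
- move=> i; rewrite -[X in (_ < X)%N](size_enum_ord r) -(size_sort le).
  by rewrite index_mem.
- move=> i i' lei; apply: (sorted_leq_index le_trans) => //.
    by move=> k; apply/lexleP.
  exact: sort_sorted.
Qed.

(** * Graded submodules of a free module *)

(** For every ideal I generated by fewer than p variables and every variable
    x_j outside I, an element of N that lies in (I + (x_j)) V is congruent
    modulo I V to x_j times an element of N. The p-th syzygy module has this
    property; it is vacuous for p = 0. *)
Definition var_saturated (K : fieldType) n (V : lmodType {mpoly K[n]})
    (N : V -> Prop) (p : nat) : Prop :=
  forall (s : seq 'I_n) j x, uniq (j :: s) -> (size s < p)%N ->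
    N x -> in_vars (j :: s) x ->
    exists y, N y /\ in_vars s (x - ('X_j : {mpoly K[n]}) *: y).

Section Graded.
Context (K : fieldType) (n : nat) (V : lmodType {mpoly K[n]}).
Context (gr : {ffun 'I_n -> int} -> V -> Prop) (hgr : zn_grading gr).
Context (r : nat) (b : 'I_r -> V) (basis_b : is_basis (fun _ => True) b).
Context (g : 'I_r -> {ffun 'I_n -> int}) (gr_b : forall i, gr (g i) (b i)).

Local Notation coord := (coord basis_b).

Lemma gr_scaleC a (c : K) x : gr a x -> gr a (c%:MP *: x).
Proof.
move=> /(zn_grading_act hgr 0%MM c).
rewrite mpolyX0 -mul_mpolyC mulr1; congr gr.
by apply/ffunP => i; rewrite !ffunE mnm0E add0r.
Qed.

Lemma gr_opp a x : gr a x -> gr a (- x).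
Proof. by move=> /(gr_scaleC (-1)); rewrite mpolyCN scaleN1r. Qed.

Lemma gr_sum a (J : Type) (s : seq J) (P : pred J) (f : J -> V) :
  (forall j, P j -> gr a (f j)) -> gr a (\sum_(j <- s | P j) f j).
Proof.
move=> grf; elim/big_rec: _ => [|j x /grf grj grx].
  exact: zn_grading_zero hgr _.
exact (zn_grading_add hgr grj grx).
Qed.

(** A homogeneous element of degree a only has terms of degree a: its sum part h
    of the terms of degree h vanishes for h <> a, because homogeneous components
    are unique. *)
Lemma gr_support a x i m :
  gr a x -> (coord x i)@_m != 0 -> multidegree m + g i = a.
Proof.
move=> grx xim.
pose deg i m : {ffun 'I_n -> int} := multidegree m + g i.
pose part h := \sum_i mfilter (fun m => deg i m == h) (coord x i) *: b i.
have gr_part h : gr h (part h).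
  apply: gr_sum => k _; rewrite scaler_suml; apply: gr_sum => m' /eqP <-.
  exact: zn_grading_act hgr _ _ _ _ (gr_b k).
pose s := undup (a :: [seq deg k m | k <- enum 'I_r, m <- msupp (coord x k)]).
have xE : x = \sum_(h <- s) part h.
  apply: (@coord_inj _ _ _ _ basis_b) => k; apply/mpolyP => m'.
  rewrite coord_bigsum raddf_sum /=.
  rewrite (eq_bigr (fun h => if deg k m' == h then (coord x k)@_m' else 0));
    last by move=> h _; rewrite coord_sum mcoeff_mfilter.
  case: (boolP (m' \in msupp (coord x k))) => xk; last first.
    rewrite -mcoeff_eq0 in xk; rewrite (eqP xk) big1 // => h _.
    by rewrite if_same.
  have ds : deg k m' \in s.
    rewrite mem_undup inE; apply/orP; right.
    by apply/allpairsPdep; exists k, m'; rewrite mem_enum.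
  rewrite (bigD1_seq _ ds) ?undup_uniq //= eqxx big1 ?addr0 // => h.
  by rewrite eq_sym => /negPf ->.
have as_ : a \in s by rewrite mem_undup mem_head.
have part0 h : h \in s -> h != a -> part h = 0.
  move=> hs ha; have [_ indep] := zn_grading_sum hgr.
  have := indep s (fun h => part h - (if h == a then x else 0)) (undup_uniq _).
  move=> /(_ _ _ h hs); rewrite (negPf ha) subr0; apply.
    move=> h'; apply: (zn_grading_add hgr) (gr_part _) (gr_opp _).
    by case: eqP => [->|_] //; apply: zn_grading_zero hgr _.
  rewrite sumrB -xE -big_mkcond /= -big_filter.
  by rewrite filter_pred1_uniq ?undup_uniq // big_seq1 subrr.
apply/eqP; apply: contraTT xim => da; rewrite negbK.
have xi : m \in msupp (coord x i) -> (coord x i)@_m = 0.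
  move=> xi; have ds : deg i m \in s.
    rewrite mem_undup inE; apply/orP; right.
    by apply/allpairsPdep; exists i, m; rewrite mem_enum.
  have := congr1 (fun y => (coord y i)@_m) (part0 _ ds da).
  by rewrite coord_sum mcoeff_mfilter eqxx coord0 mcoeff0.
by case: (boolP (m \in msupp (coord x i))) => [/xi ->|]; rewrite ?mcoeff_eq0.
Qed.

Context (N : V -> Prop) (hN : graded_submodule gr N).

Lemma graded_submodule_bigsum (J : Type) (s : seq J) (P : pred J) (f : J -> V) :
  (forall j, P j -> N (f j)) -> N (\sum_(j <- s | P j) f j).
Proof.
move=> Nf; elim/big_rec: _ => [|j x /Nf Nj Nx].
  exact: graded_submodule_zero hN.
exact (graded_submodule_add hN Nj Nx).
Qed.

Lemma graded_submodule_sub x y : N x -> N y -> N (x - y).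
Proof.
move=> Nx Ny; apply: (graded_submodule_add hN) Nx _.
by rewrite -scaleN1r; apply: graded_submodule_scale hN _ _ Ny.
Qed.

(** The component of degree a of x belongs to N and consists of the terms of x
    of degree a. *)
Lemma graded_component x a : N x ->
  exists y, [/\ N y, gr a y & forall i m,
    (coord y i)@_m = if multidegree m + g i == a then (coord x i)@_m else 0].
Proof.
have [/(_ x)[decomp _] _] := graded_submodule_sum hN.
move=> /decomp[s [f [us grf ->]]].
have coef i m : (coord (\sum_(h <- s) f h) i)@_m =
   if multidegree m + g i \in s then (coord (f (multidegree m + g i)) i)@_m
   else 0.
  rewrite coord_bigsum raddf_sum /=.
  have off h : h != multidegree m + g i -> (coord (f h) i)@_m = 0.
    move=> ne; apply/eqP; apply: contraTT ne.
    move=> /(gr_support (proj1 (grf h))) ->.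
    by rewrite negbK.
  case: (boolP (_ \in s)) => ds.
    by rewrite (bigD1_seq _ ds) //= big1 ?addr0.
  rewrite big_seq big1 // => h hs; apply: off.
  by apply: contraNneq ds => <-.
exists (if a \in s then f a else 0); split.
- by case: ifP => _; [case: (grf a) | apply: graded_submodule_zero hN].
- by case: ifP => _; [case: (grf a) | apply: zn_grading_zero hgr _].
- move=> i m; rewrite coef; case: eqP => [->|ne].
    by case: ifP => // _; rewrite coord0 mcoeff0.
  case: ifP => _; last by rewrite coord0 mcoeff0.
  apply/eqP; apply/negPn/negP => /(gr_support (proj1 (grf a))).
  exact: ne.
Qed.

Context (rho : 'I_r -> nat).
Context (rho_lex : forall i i', (rho i <= rho i')%N -> lexle (g i) (g i')).

(** z is a homogeneous element of N with leading term x^m b_i, of coefficient 1,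
    where terms are compared by the rank rho of their basis elements. If the
    basis elements are ranked along their degrees, then the exponent of the
    leading term is the lexicographically smallest one in z. *)
Definition is_lead (i : 'I_r) (m : 'X_{1..n}) (z : V) : Prop :=
  [/\ N z, gr (multidegree m + g i) z,
      forall i', (rho i < rho i')%N -> coord z i' = 0
    & coord z i = 'X_[m]].

Lemma is_leadMX t i m z :
  is_lead i m z -> is_lead i (t + m) (('X_[t] : {mpoly K[n]}) *: z).
Proof.
case=> Nz grz z0 zi; split.
- exact: graded_submodule_scale hN _ _ Nz.
- by have := zn_grading_act hgr t 1 grz; rewrite scale1r multidegreeD.
- by move=> i' /z0; rewrite coordZ => ->; rewrite mulr0.
- by rewrite coordZ zi mpolyXD.
Qed.

Lemma lead_mono_ideal i : mono_ideal (fun m => exists z, is_lead i m z).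
Proof.
move=> m m' le [z hz]; exists (('X_[m' - m] : {mpoly K[n]}) *: z).
by have := is_leadMX (m' - m)%MM hz; rewrite submK.
Qed.

(** The initial module is generated by terms x^m b_i with m free of the first p
    variables. If x_j, with j < p, is the first variable that divides the
    leading monomial of z, then every term of z is divisible by x_j or by an
    earlier variable, because the leading exponent is the smallest one.
    Saturation with respect to these variables gives an element of N whose
    leading monomial is that of z divided by x_j. *)
Lemma lead_zero_below p : var_saturated N p -> forall i m,
  (exists z, is_lead i m z) -> exists z, is_lead i (zero_below p m) z.
Proof.
move=> sat i m; have [q] := ubnP (mdeg m); elim: q m => // q IHq m mq [z lz].
case: (pickP (fun j : 'I_n => (j < p)%N && (m j != 0%N))) => [j0 hj0|no].
  have := @arg_minnP _ j0 (fun j : 'I_n => (j < p)%N && (m j != 0%N)) val hj0.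
  case=> j /andP[jp mj] minj.
  have mlow (k : 'I_n) : (k < j)%N -> m k = 0%N.
    move=> kj; apply/eqP/negPn/negP => mk.
    by have := minj k; rewrite (ltn_trans kj jp) mk leqNgt kj => /(_ isT).
  pose s := take j (enum 'I_n).
  have sP (k : 'I_n) : (k \in s) = (k < j)%N.
    by rewrite in_take ?mem_enum // index_enum_ord.
  have us : uniq (j :: s) by rewrite /= sP ltnn take_uniq ?enum_uniq.
  have ss : (size s < p)%N by rewrite size_take size_enum_ord ltn_ord.
  have [Nz grz zlt zi] := lz.
  (* A term free of x_j and of the earlier variables would have a smaller
     exponent than the leading term. *)
  have zin : in_vars (j :: s) z.
    apply/(in_varsP basis_b) => i' m' m'0; apply/eqP/negPn/negP => nz.
    have deg k : (m' k)%:Z + g i' k = (m k)%:Z + g i k.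
      by have /ffunP/(_ k) := gr_support grz nz; rewrite !ffunE.
    have le : (rho i' <= rho i)%N.
      by rewrite leqNgt; apply: contraNN nz => /zlt ->; rewrite mcoeff0.
    have /lexleP/(_ j) := rho_lex le; have := deg j.
    rewrite m'0 ?mem_head // add0r => ->.
    rewrite gerDr => /(_ _)/wrap[k kj|].
      have := deg k; rewrite m'0 ?inE ?sP ?kj ?orbT //.
      by rewrite mlow // !add0r.
    by move: mj; case: (m j).
  have [w [Nw hw]] := sat s j z us ss Nz zin.
  (* Off the earlier variables, the coefficients of w are those of z / x_j. *)
  have wz i' (m' : 'X_{1..n}) : (forall k : 'I_n, (k < j)%N -> m' k = 0%N) ->
      (coord w i')@_m' = (coord z i')@_(U_(j) + m').
    move=> m'0; have /(in_varsP basis_b)/(_ i' (U_(j) + m')%MM) := hw.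
    rewrite coordB coordZ mcoeffB mcoeffMX_ge ?lem_addr //.
    rewrite [X in _@_(X - _)]addmC addmK => /(_ _)/wrap[k|/eqP].
      rewrite sP mnmDE mnm1E => kj; rewrite m'0 //.
      by case: eqP kj => // ->; rewrite ltnn.
    by rewrite subr_eq0 => /eqP.
  have mE : (U_(j) + (m - U_(j)))%MM = m.
    rewrite addmC submK //; apply/mnm_lepP => k.
    by rewrite mnm1E; case: eqP => [<-|//]; rewrite lt0n.
  have mUlow (k : 'I_n) : (k < j)%N -> (m - U_(j))%MM k = 0%N.
    by move=> kj; rewrite mnmBE mlow.
  have [y [Ny gry yE]] := graded_component (multidegree (m - U_(j)) + g i) Nw.
  (* If a basis element ranked above b_i carries a term of y, then its degree
     agrees with that of b_i at the indices before j, so that this term is free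
     of the earlier variables. Then it is a term of z / x_j, where no term is
     ranked above b_i. *)
  have ly : is_lead i (m - U_(j)) y.
    split=> // [i' lti|]; apply/mpolyP => m'; rewrite yE.
      rewrite mcoeff0; case: eqP => // /ffunP deg.
      have {}deg k : (m' k)%:Z + g i' k = ((m - U_(j))%MM k)%:Z + g i k.
        by have := deg k; rewrite !ffunE.
      have /lexleP le := rho_lex (ltnW lti).
      have eg (k : 'I_n) : (k < j)%N -> g i k = g i' k.
        have [t] := ubnP k; elim: t k => // t IHt k kt kj.
        have := deg k; rewrite mUlow // add0r => dk; apply: le_anti.
        rewrite le -?dk ?lerDr //= => k' k'k.
        exact: IHt (leq_trans k'k kt) (ltn_trans k'k kj).
      rewrite wz ?zlt ?mcoeff0 // => k kj.
      have := deg k; rewrite mUlow // add0r eg //.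
      by move=> /eqP; rewrite -subr_eq0 addrK => /eqP[].
    rewrite mcoeffX; case: eqP => [/multidegree_inj ->|ne].
      by rewrite wz // mE zi mcoeffX !eqxx.
    by case: eqP => // e; case: ne; rewrite e.
  have -> : zero_below p m = zero_below p (m - U_(j)).
    apply/mnmP => k; rewrite !mnmE; case: ifP => // kp.
    case: eqP => [e|_]; last by rewrite subn0.
    by rewrite -e jp in kp.
  apply: IHq; last by exists y.
  by rewrite -mE mdegD mdeg1 in mq.
exists z; suff -> : zero_below p m = m by [].
apply/mnmP => k; rewrite mnmE; case: ifP => // kp.
by have := no k; rewrite kp /= => /negbFE/eqP.
Qed.

End Graded.

(** * Stanley decompositions from boxes of leading monomials *)

Section PolyInVars.
Context (K : fieldType) (n : nat) (Z : {set 'I_n}).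
Implicit Types f h : {mpoly K[n]}.

Lemma poly_in_vars0 : poly_in_vars Z (0 : {mpoly K[n]}).
Proof. by move=> m; rewrite msupp0. Qed.

Lemma poly_in_varsD f h :
  poly_in_vars Z f -> poly_in_vars Z h -> poly_in_vars Z (f + h).
Proof.
move=> Zf Zh m /msuppD_le; rewrite mem_cat => /orP[]; first exact: Zf.
exact: Zh.
Qed.

Lemma in_box_msupp a f t :
  poly_in_vars Z f -> t \in msupp f -> in_box a Z (t + a).
Proof.
move=> Zf tf i; rewrite mnmDE leq_addl; split=> // iZ.
have /(_ i) := Zf _ tf; case: (t i) => // t' /(_ isT).
by rewrite (negPf iZ).
Qed.

Lemma poly_in_vars_box (c : K) a m :
  in_box a Z m -> poly_in_vars Z (c *: 'X_[m - a] : {mpoly K[n]}).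
Proof.
move=> bm m' /msuppZ_le/mem_msuppXP <- i; rewrite mnmBE => d.
apply: contraNT d => iZ; have [_ /(_ iZ) ->] := bm i.
by rewrite subnn.
Qed.

End PolyInVars.

Section Boxes.
Context (K : fieldType) (n : nat) (V : lmodType {mpoly K[n]}).
Context (gr : {ffun 'I_n -> int} -> V -> Prop) (hgr : zn_grading gr).
Context (r : nat) (b : 'I_r -> V) (basis_b : is_basis (fun _ => True) b).
Context (g : 'I_r -> {ffun 'I_n -> int}) (gr_b : forall i, gr (g i) (b i)).
Context (N : V -> Prop) (hN : graded_submodule gr N).
Context (rho : 'I_r -> nat) (rho_inj : injective rho).
Context (rho_lt : forall i, (rho i < r)%N).

Local Notation coord := (coord basis_b).
Local Notation is_lead := (is_lead gr basis_b g N rho).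

(* The boxes x^(a j) K[Z j] with e j = i partition the leading exponents of N on
   b_i, and u j is an element of N whose leading term is the corner of the
   box. *)
Context (k : nat) (e : 'I_k -> 'I_r) (a : 'I_k -> 'X_{1..n}).
Context (Z : 'I_k -> {set 'I_n}) (u : 'I_k -> V).
Context (lead_u : forall j, is_lead (e j) (a j) (u j)).
Context (box_cover : forall i m, (exists z, is_lead i m z) ->
  exists j, e j = i /\ in_box (a j) (Z j) m).
Context (box_disjoint : forall m j j', e j = e j' ->
  in_box (a j) (Z j) m -> in_box (a j') (Z j') m -> j = j').

(** In a relation, the coefficient of the u j with the largest leading rank is
    zero: on the basis element e j only the u j' with the same leading basis
    element contribute, and they contribute distinct monomials since the boxes
    are disjoint. *)
Lemma boxes_independent (f : 'I_k -> {mpoly K[n]}) :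
  (forall j, poly_in_vars (Z j) (f j)) -> \sum_j f j *: u j = 0 ->
  forall j, f j = 0.
Proof.
move=> Zf sum0 j; have [q] := ubnP (r - rho (e j))%N.
elim: q j => // q IHq j hq; apply/mpolyP => t; rewrite mcoeff0.
apply/eqP/negPn/negP => ft.
have := congr1 (fun x => (coord x (e j))@_(t + a j)) sum0.
rewrite coord0 mcoeff0 coord_bigsum raddf_sum /= (bigD1 j) //= big1.
  have [_ _ _ uj] := lead_u j.
  by rewrite coordZ uj addmC mcoeffMX addr0 => /eqP; apply/negP.
move=> j' j'j; rewrite coordZ; have [_ _ u0 uj'] := lead_u j'.
have := rho_lt (e j); have := rho_lt (e j').
case: (ltngtP (rho (e j')) (rho (e j))) => [lt|gt|/rho_inj eqe] lt1 lt2.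
- by rewrite u0 // mulr0 mcoeff0.
- by rewrite IHq ?mul0r ?mcoeff0 //; lia.
- rewrite -eqe uj' mulrC; case: (boolP (a j' <= t + a j)%MM) => le; last first.
    by rewrite mcoeffMX_nge.
  rewrite mcoeffMX_ge //; apply/eqP/negPn/negP => ft'.
  case/eqP: j'j; apply: (box_disjoint (m := (t + a j)%MM)) => //.
    rewrite -(submK le); apply: in_box_msupp (Zf j') _.
    by rewrite mcoeff_msupp.
  by apply: in_box_msupp (Zf j) _; rewrite mcoeff_msupp.
Qed.

Let spanned x := exists f : 'I_k -> {mpoly K[n]},
  (forall j, poly_in_vars (Z j) (f j)) /\ x = \sum_j f j *: u j.

Let spanned0 : spanned 0.
Proof.
exists (fun=> 0); split=> [j|]; first exact: poly_in_vars0.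
by rewrite big1 // => j _; rewrite scale0r.
Qed.

Let spannedD x y : spanned x -> spanned y -> spanned (x + y).
Proof.
move=> [f [Zf ->]] [h [Zh ->]]; exists (fun j => f j + h j); split=> [j|].
  exact: poly_in_varsD.
by rewrite -big_split /=; apply: eq_bigr => j _; rewrite scalerDl.
Qed.

(* The leading term of x is cancelled by a term multiple of the u j whose box
   contains its exponent; the induction is on a bound for the leading rank. *)
Let spanned_homogeneous h x : N x -> gr h x -> spanned x.
Proof.
suff below q y : N y -> gr h y ->
    (forall i, (q <= rho i)%N -> coord y i = 0) -> spanned y.
  by move=> Nx grx; apply: (below r) => // i; rewrite leqNgt rho_lt.
elim: q y => [|q IHq] {}x Nx grx x0.
  suff -> : x = 0 by exact: spanned0.
  by apply: (@coord_inj _ _ _ _ basis_b) => i; rewrite x0 // coord0.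
case: (classic (exists i m, rho i = q /\ (coord x i)@_m != 0)); last first.
  move=> no; apply: IHq => // i.
  rewrite leq_eqVlt => /predU1P[qi|]; last exact: x0.
  apply/mpolyP => m; rewrite mcoeff0; apply/eqP/negPn/negP => nz.
  by apply: no; exists i, m.
move=> [i [m [rhoi nz]]]; pose c := (coord x i)@_m.
have hE : multidegree m + g i = h := gr_support hgr gr_b grx nz.
have xi : coord x i = c *: 'X_[m].
  apply/mpolyP => m'; rewrite mcoeffZ mcoeffX; case: eqP => [<-|ne].
    by rewrite mulr1.
  rewrite mulr0; apply/eqP/negPn/negP.
  move=> /(gr_support hgr gr_b grx); rewrite -hE.
  by move=> /multidegree_inj e'; apply: ne.
have lx : is_lead i m (c^-1%:MP *: x).
  split.
  - exact: graded_submodule_scale hN _ _ Nx.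
  - by rewrite hE; apply: gr_scaleC.
  - by move=> i'; rewrite rhoi => qi'; rewrite coordZ x0 // mulr0.
  - by rewrite coordZ xi mul_mpolyC scalerA mulVf // scale1r.
have [j [ej bj]] := box_cover (ex_intro _ _ lx).
have aE : (m - a j + a j)%MM = m.
  by apply: submK; apply/mnm_lepP => l; case: (bj l).
pose f : {mpoly K[n]} := c *: 'X_[m - a j].
have [Nu gru u0 uj] := lead_u j.
have -> : x = (x - f *: u j) + f *: u j by rewrite subrK.
apply: spannedD; last first.
  exists (fun j' => if j' == j then f else 0); split=> [j'|].
    by case: eqP => [->|_]; [exact: poly_in_vars_box | exact: poly_in_vars0].
  rewrite (bigD1 j) //= eqxx big1 ?addr0 // => j' /negPf ->.
  by rewrite scale0r.
apply: IHq.
- exact: (graded_submodule_sub hN) Nx (graded_submodule_scale hN _ Nu).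
- apply: zn_grading_add hgr _ _ _ grx _; apply: gr_opp => //.
  have := zn_grading_act hgr (m - a j)%MM c gru.
  by rewrite -multidegreeD aE ej hE.
- move=> i'; rewrite leq_eqVlt coordB coordZ => /predU1P[qi'|qi'].
    have -> : i' = i by apply: rho_inj; rewrite rhoi.
    rewrite -{2}ej uj xi /f -scalerAl -mpolyXD aE.
    by rewrite subrr.
  by rewrite x0 // u0 ?mulr0 ?subrr // ej rhoi.
Qed.

Lemma boxes_span x : N x -> exists f : 'I_k -> {mpoly K[n]},
  (forall j, poly_in_vars (Z j) (f j)) /\ x = \sum_j f j *: u j.
Proof.
have [/(_ x)[decomp _] _] := graded_submodule_sum hN.
move=> /decomp[s [f [_ grf ->]]]; rewrite -/(spanned _).
elim/big_rec: _ => [|h y _ hy]; first exact: spanned0.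
apply: spannedD hy; have [grh Nh] := grf h.
exact: spanned_homogeneous Nh grh.
Qed.

Lemma boxes_stanley : stanley_decomposition gr N u Z.
Proof.
split.
- by move=> j; case: (lead_u j).
- by move=> j; exists (multidegree (a j) + g (e j)); case: (lead_u j).
- move=> j f Zf fu.
  have [_ _ _ uj] := lead_u j.
  apply/mpolyP => t; have := congr1 (fun x => (coord x (e j))@_(t + a j)) fu.
  by rewrite coordZ uj addmC mcoeffMX coord0 !mcoeff0.
split=> [x|s v us Wv sum0 j js].
  split=> [/boxes_span[f [Zf ->]]|[s [v [_ Wv ->]]]].
    exists (enum 'I_k), (fun j => f j *: u j); split=> [|j|].
    - exact: enum_uniq.
    - by exists (f j).
    - by rewrite big_enum.
  apply: (graded_submodule_bigsum hN) => j _; have [f _ ->] := Wv j.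
  by apply: graded_submodule_scale hN _ _ _; case: (lead_u j).
have exf j' : exists f, poly_in_vars (Z j') f /\ v j' = f *: u j'.
  by have [f Zf vE] := Wv j'; exists f.
pose f j' := proj1_sig (constructive_indefinite_description _ (exf j')).
have fP j' : poly_in_vars (Z j') (f j') /\ v j' = f j' *: u j'.
  by rewrite /f; case: constructive_indefinite_description.
pose f' j' := if j' \in s then f j' else 0.
have : f' j = 0.
  apply: boxes_independent => [j'|].
    by rewrite /f'; case: ifP => _; [case: (fP j') | exact: poly_in_vars0].
  apply: etrans sum0; rewrite (big_uniq _ us) [RHS]big_mkcond /=.
  apply: eq_bigr => j' _.
  by rewrite /f'; case: ifP => _; rewrite ?scale0r //; case: (fP j').
by rewrite /f' js; have [_ ->] := fP j => ->; rewrite scale0r.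
Qed.

Lemma full_boxes_free : (forall j, Z j = setT) -> is_free N.
Proof.
move=> ZT; exists k, u; split=> [j|x /boxes_span[f [_ ->]]|c sum0 j].
- by case: (lead_u j).
- by exists f.
- by apply: boxes_independent sum0 j => j m _ i _; rewrite ZT inE.
Qed.

End Boxes.

(** * Stanley depth of syzygy modules *)

Lemma decomposition_depth_le n r (Z : 'I_r -> {set 'I_n}) :
  (decomposition_depth Z <= n)%N.
Proof.
rewrite /decomposition_depth; elim/big_rec: _ => // i d _ h.
by rewrite geq_min h orbT.
Qed.

Lemma decomposition_depth_ge n r (Z : 'I_r -> {set 'I_n}) q :
  (q <= n)%N -> (forall i, (q <= #|Z i|)%N) -> (q <= decomposition_depth Z)%N.
Proof.
move=> qn qZ; rewrite /decomposition_depth.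
by elim/big_rec: _ => // i d _ h; rewrite leq_min qZ.
Qed.

(** For p < n the boxes have at least p + 1 free directions; for p >= n all
    directions are free. *)
Theorem sdepth_var_saturated (K : fieldType) (n : nat)
    (V : lmodType {mpoly K[n]}) (gr : {ffun 'I_n -> int} -> V -> Prop)
    (N : V -> Prop) (p : nat) :
  fg_graded_free gr -> graded_submodule gr N -> var_saturated N p ->
  (exists2 s : nat, is_sdepth gr N s & (p.+1 <= s)%N) \/ is_free N.
Proof.
move=> [hgr [r [b [basis_b exg]]]] hN sat.
pose g i := proj1_sig (constructive_indefinite_description _ (exg i)).
have gr_b i : gr (g i) (b i).
  by rewrite /g; case: constructive_indefinite_description.
have [rho [rho_inj rho_lt rho_lex]] := exists_lex_rank g.
pose U i m := exists z, is_lead gr basis_b g N rho i m z.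
have upU i : mono_ideal (U i) by exact: (lead_mono_ideal hgr hN).
have zU i m : U i m -> U i (zero_below p m).
  exact: (lead_zero_below hgr gr_b hN rho_lex sat).
have [k [e [a [Z [Ua cov dis Zp]]]]] := box_partition upU zU.
pose u j := proj1_sig (constructive_indefinite_description _ (Ua j)).
have lead_u j : is_lead gr basis_b g N rho (e j) (a j) (u j).
  by rewrite /u; case: constructive_indefinite_description.
case: (ltnP p n) => [pn|np]; [left|right]; last first.
  apply: (full_boxes_free hgr gr_b hN rho_inj rho_lt lead_u cov dis) => j.
  by apply/setP => i; rewrite inE Zp // (leq_trans _ np) // ltnW.
have st := boxes_stanley hgr gr_b hN rho_inj rho_lt lead_u cov dis.
pose P s := exists (r : nat) (u : 'I_r -> V) (Z : 'I_r -> {set 'I_n}),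
  stanley_decomposition gr N u Z /\ decomposition_depth Z = s.
have PZ : P (decomposition_depth Z) by exists k, u, Z.
have Pn s : P s -> (s <= n)%N.
  by move=> [r' [u' [Z' [_ <-]]]]; apply: decomposition_depth_le.
have [s [Ps ge max_s]] := exists_max_nat PZ Pn.
exists s; first by split=> // r' u' Z' st'; apply: max_s; exists r', u', Z'.
apply: leq_trans ge; apply: decomposition_depth_ge => // j.
have widen_inj : injective (widen_ord pn).
  by move=> i i' /(congr1 val) /= /val_inj.
rewrite -[p.+1]card_ord -(card_imset _ widen_inj).
apply/subset_leq_card/subsetP => _ /imsetP[i _ ->].
by apply: Zp; rewrite -ltnS /=.
Qed.

Lemma syzygy_graded
    (K : fieldType) (n : nat) (F : nat -> lmodType {mpoly K[n]})
    (gr : forall p : nat, {ffun 'I_n -> int} -> F p -> Prop)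
    (d : forall p : nat, {linear F p.+1 -> F p}) (M : F 0%N -> Prop)
    (hfree : forall p, fg_graded_free (gr p))
    (hM : graded_submodule (gr 0%N) M)
    (hF : graded_free_resolution gr d M) (p : nat) :
  graded_submodule (gr p) (syzygy d M p).
Proof.
case: p => //= p; split.
- by rewrite linear0.
- by move=> x y dx dy; rewrite linearD dx dy addr0.
- by move=> c x dx; rewrite linearZ /= dx scaler0.
have [hgr _] := hfree p.+1; have [hgr' _] := hfree p.
have [decomp indep] := zn_grading_sum hgr.
have [_ indep'] := zn_grading_sum hgr'.
split=> [x|s f us Wf]; last by apply: indep => // h; case: (Wf h).
split=> [dx|[s [f [_ Wf ->]]]]; last first.
  by rewrite linear_sum big1 // => h _; case: (Wf h).
have [s [f [us grf xE]]] := (decomp x).1 I.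
have dfs h : h \in s -> d p (f h) = 0.
  apply: (indep' s (fun h => d p (f h))) => // [h'|].
    exact: (resolution_graded hF) (grf h').
  by rewrite -linear_sum -xE.
exists s, (fun h => if h \in s then f h else 0); split=> // [h|].
  case: ifP => [hs|_]; first by split=> //; apply: dfs.
  by rewrite linear0; split=> //; apply: zn_grading_zero hgr _.
by rewrite xE !big_seq; apply: eq_bigr => h ->.
Qed.

(** If z is a cycle with z - x_j y in I F, then x_j d y lies in I F, and so does
    d y because x_j is regular modulo I; hence y is congruent to a cycle
    modulo I. *)
Lemma syzygy_saturated
    (K : fieldType) (n : nat) (F : nat -> lmodType {mpoly K[n]})
    (gr : forall p : nat, {ffun 'I_n -> int} -> F p -> Prop)
    (d : forall p : nat, {linear F p.+1 -> F p}) (M : F 0%N -> Prop)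
    (hfree : forall p, fg_graded_free (gr p))
    (hF : graded_free_resolution gr d M) (p : nat) :
  var_saturated (syzygy d M p) p.
Proof.
case: p => [|p] s j z //= /andP[js us] ss dz [y hy].
have [_ [r [b [basis_b _]]]] := hfree p.
have hdy : in_vars s (d p y).
  apply: (in_vars_regular basis_b js).
  have := in_vars_linear (d p) hy.
  by rewrite linearB linearZ dz sub0r => /in_varsN; rewrite opprK.
have F_free q : exists (r : nat) (b : 'I_r -> F q), is_basis (fun=> True) b.
  by have [_ [r' [b' [basis_b' _]]]] := hfree q; exists r', b'.
have [w [dw hw]] := lift_cycle F_free (resolution_exact hF) us ss hdy.
exists w; split=> //.
have := in_varsD hy (in_varsZ 'X_j hw).
by rewrite scalerBr addrA subrK.
Qed.

Theorem theorem2p2 (K : fieldType) (n : nat)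
    (F : nat -> lmodType {mpoly K[n]})
    (gr : forall p : nat, {ffun 'I_n -> int} -> F p -> Prop)
    (d : forall p : nat, {linear F p.+1 -> F p})
    (M : F 0%N -> Prop)
    (hF0 : fg_graded_free (gr 0%N))
    (hM : graded_submodule (gr 0%N) M)
    (hF : graded_free_resolution gr d M) :
  forall p : nat,
    (exists2 s : nat, is_sdepth (gr p) (syzygy d M p) s & (p.+1 <= s)%N)
    \/ is_free (syzygy d M p).
Proof.
have hfree p : fg_graded_free (gr p).
  by case: p => // p; apply: resolution_free hF p.
move=> p; apply: sdepth_var_saturated (hfree p) _ _.
  exact: syzygy_graded.
exact: (syzygy_saturated hfree hF).
Qed.
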